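(* The threshold bias for the connectivity game $\mathcal{C}(K_m,n)$ is $m=\Theta\big(\sqrt{n/\ln n}\big)$.
   Context: $\mathcal{C}(K_m,n)$ is the following game on the edge set of $K_n$ ($n$ large): players alternate; on each turn Maker claims one unclaimed edge, and Breaker claims any set of unclaimed edges all of whose endpoints lie in some set of $m$ vertices (a subgraph of a copy of $K_m$). The game ends when no unclaimed edges remain. Maker wins if her graph contains a spanning tree of $K_n$ (i.e. is connected and spanning); otherwise Breaker wins. The threshold bias is the value $m_0(n)$ such that Breaker wins if $m>m_0$ and Maker wins if $m\le m_0$. Convention: when considering Maker strategies Breaker makes the first move, and when considering Breaker strategies Maker makes the first move. *)

(* Defs.v *)
From mathcomp Require Import all_boot.

Set Implicit Arguments.
Unset Strict Implicit.
Unset Printing Implicit Defensive.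

(** The connectivity game C(K_m, n), played on the edge set of K_n. *)

Inductive player := Maker | Breaker.

Definition opponent (pl : player) : player :=
  match pl with Maker => Breaker | Breaker => Maker end.

(** An edge of K_n is a 2-element subset of the vertex set ['I_n]. *)
Definition edges (n : nat) : {set {set 'I_n}} := [set e : {set 'I_n} | #|e| == 2].

Record position (n : nat) := Position {
  to_move : player;
  maker_edges : {set {set 'I_n}};
  breaker_edges : {set {set 'I_n}} }.

Definition start (n : nat) (first : player) : position n :=
  Position first set0 set0.

Definition unclaimed (n : nat) (p : position n) : {set {set 'I_n}} :=
  edges n :\: (maker_edges p :|: breaker_edges p).

(** [#|A| <= m] rather than [#|A| = m]: the two agree when [m <= n] (enlarge
    [A]), and the former also makes sense of the game for [m > n].  Breaker may
    claim no edge at all; for [m <= 1] this is his only move. *)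
Definition legal (n m : nat) (p : position n) (S : {set {set 'I_n}}) : bool :=
  (S \subset unclaimed p) &&
  match to_move p with
  | Maker => #|S| == 1
  | Breaker => [exists A : {set 'I_n}, (#|A| <= m) && (cover S \subset A)]
  end.

Definition claim (n : nat) (p : position n) (S : {set {set 'I_n}}) : position n :=
  match to_move p with
  | Maker => Position Breaker (maker_edges p :|: S) (breaker_edges p)
  | Breaker => Position Maker (maker_edges p) (breaker_edges p :|: S)
  end.

(** A graph on ['I_n] with edge set [E] contains a spanning tree of K_n iff it
    is connected on the whole vertex set. *)
Definition spanning_connected (n : nat) (E : {set {set 'I_n}}) : Prop :=
  forall u v : 'I_n, connect (fun x y => [set x; y] \in E) u v.

Definition won_by (n : nat) (pl : player) (p : position n) : Prop :=
  match pl with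
  | Maker => spanning_connected (maker_edges p)
  | Breaker => ~ spanning_connected (maker_edges p)
  end.

(** A strategy chooses the set of edges to claim from the current position and
    the list of earlier positions, latest first. *)
Definition strategy (n : nat) : Type :=
  position n -> seq (position n) -> {set {set 'I_n}}.

(** [arises m first pl sigma p h]: in the game where [first] moves first and
    [pl] follows [sigma], while the opponent plays any legal moves, position
    [p] can be reached through the earlier positions [h]. *)
Inductive arises (n m : nat) (first pl : player) (sigma : strategy n) :
    position n -> seq (position n) -> Prop :=
| arises_start : arises m first pl sigma (start n first) [::]
| arises_own p h :
    arises m first pl sigma p h -> unclaimed p <> set0 ->
    to_move p = pl ->
    arises m first pl sigma (claim p (sigma p h)) (p :: h)
| arises_opponent p h S :
    arises m first pl sigma p h -> unclaimed p <> set0 ->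
    to_move p = opponent pl -> legal m p S ->
    arises m first pl sigma (claim p S) (p :: h).

(** Every play ends, since each Maker move uses up an unclaimed edge; so it is
    enough to look at the final positions. *)
Definition winning_strategy (n m : nat) (first pl : player)
    (sigma : strategy n) : Prop :=
  forall p h, arises m first pl sigma p h ->
    (unclaimed p <> set0 -> to_move p = pl -> legal m p (sigma p h)) /\
    (unclaimed p = set0 -> won_by pl p).

Definition wins (n m : nat) (first pl : player) : Prop :=
  exists sigma : strategy n, winning_strategy m first pl sigma.

(** Relative to the player who moves first: with a fixed first player, one of the
    two players wins, whereas no single [m0] need work if each player is made to
    win moving second. *)
Definition threshold_bias (n : nat) (first : player) (m0 : nat) : Prop :=
  forall m : nat,
    (m0 < m -> wins n m first Breaker) /\ (m <= m0 -> wins n m first Maker).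

(* Main.v *)
(** Maker and Breaker each win by a greedy argument.

    Maker needs an edge in every cut.  A Breaker move has at most [m ^ 2] edges,
    so she plays the biased Erdős–Selfridge (Beck) strategy: an unhit cut with
    [r] unclaimed edges has weight [lam ^- r] with [lam = expR (1 / (2 m^2))],
    and claiming the edge of largest total weight keeps the sum below [1].  The
    initial sum over cuts is at most [(1 + lam ^- (n/2)) ^ n - 1], which is
    small once [m <= sqrt (n / ln n) / 5].

    Breaker isolates a vertex.  Split the vertices into blocks of size
    [s = m / 2].  In level [i] he joins all vertices not yet touched by Maker to
    the [i]-th block, [s] of them per move.  Maker touches two vertices per
    move, so a level costs a fraction [2 / s] of the survivors, and about
    [n * exp (- 2 n / s^2)] vertices outlive all [n / s] levels.

    Winning is a safety condition, so both players' winning regions are greatest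
    fixpoints; determinacy follows without induction on the length of play. *)

Require Import Defs.
From mathcomp Require Import all_boot.
From mathcomp Require Import boolp.
Set Implicit Arguments.
Unset Strict Implicit.
Unset Printing Implicit Defensive.

(** * Safe sets of positions, determinacy, monotonicity in the bias *)

Definition safe (n m : nat) (pl : player) (I : position n -> Prop) : Prop :=
  forall p, I p ->
    [/\ unclaimed p = set0 -> won_by pl p,
        unclaimed p <> set0 -> to_move p = pl ->
          exists2 S, legal m p S & I (claim p S)
      & unclaimed p <> set0 -> to_move p = opponent pl ->
          forall S, legal m p S -> I (claim p S)].

Lemma safe_wins (n m : nat) (first pl : player) (I : position n -> Prop) :
  safe m pl I -> I (start n first) -> wins n m first pl.
Proof.
move=> sI I0.
pose good p S := `[< legal m p S /\ I (claim p S) >].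
pose sigma : strategy n := fun p _ => odflt set0 [pick S | good p S].
have sigmaP p h : I p -> unclaimed p <> set0 -> to_move p = pl ->
    legal m p (sigma p h) /\ I (claim p (sigma p h)).
  move=> Ip up tp; have [_ /(_ up tp) [S lS IS] _] := sI _ Ip.
  rewrite /sigma; case: pickP => [S' /asboolP//|/(_ S) /negbT /asboolP nS].
  by case: nS.
exists sigma => p h ar.
have Ip : I p.
  elim: ar => {p h} [//|p h _ Ip up tp|p h S _ Ip up tp lS].
    by have [] := sigmaP p h Ip up tp.
  by have [_ _ /(_ up tp S lS)] := sI _ Ip.
split=> [up tp|up]; first by have [] := sigmaP p h Ip up tp.
by have [/(_ up)] := sI _ Ip.
Qed.

(** The union of all safe sets. By [safe_can_win] it is itself safe, hence the greatest fixpoint. *)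
Definition can_win (n m : nat) (pl : player) (p : position n) : Prop :=
  exists2 I, safe m pl I & I p.

Lemma safe_can_win (n m : nat) (pl : player) :
  safe m pl (@can_win n m pl).
Proof.
move=> p [I sI Ip]; have [w own opp] := sI p Ip; split=> // up tp.
  by have [S lS IS] := own up tp; exists S => //; exists I.
by move=> S lS; exists I => //; apply: opp.
Qed.

(** The premises are what keeps the greatest safe set safe after [p] is added to it. *)
Lemma can_win_step (n m : nat) (pl : player) (p : position n) :
  (unclaimed p = set0 -> won_by pl p) ->
  (unclaimed p <> set0 -> to_move p = pl ->
     exists2 S, legal m p S & can_win m pl (claim p S)) ->
  (unclaimed p <> set0 -> to_move p = opponent pl ->
     forall S, legal m p S -> can_win m pl (claim p S)) ->
  can_win m pl p.
Proof.
move=> w own opp; exists (fun q => q = p \/ can_win m pl q); last by left.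
move=> q [->|/safe_can_win [w' own' opp']]; split=> // uq tq.
- by have [S] := own uq tq; exists S => //; right.
- by move=> S lS; right; apply: opp.
- by have [S] := own' uq tq; exists S => //; right.
- by move=> S lS; right; apply: opp'.
Qed.

(** At each kind of position the other premises of [can_win_step] are vacuous, so its contrapositive
    gives what safety asks of Breaker. *)
Lemma not_can_win_safe (n m : nat) :
  safe m Breaker (fun p : position n => ~ can_win m Maker p).
Proof.
move=> p np; split=> [up|up tp|up tp S lS].
- move=> sc; apply: np; apply: can_win_step => // up'; by case: up'.
- apply: contrapT => nS; apply: np; apply: can_win_step => //; first by rewrite tp.
  move=> _ _ S lS; apply: contrapT => nw; apply: nS; by exists S.
- move=> cw; apply: np; apply: can_win_step => //; last by rewrite tp.
  by move=> _ _; exists S.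
Qed.

Lemma determinacy (n m : nat) (first : player) :
  wins n m first Maker \/ wins n m first Breaker.
Proof.
have [cw|ncw] := pselect (can_win m Maker (start n first)).
  by left; apply: safe_wins cw; apply: safe_can_win.
by right; apply: safe_wins ncw; apply: not_can_win_safe.
Qed.

Lemma legal_leq (n m m' : nat) (p : position n) S :
  m <= m' -> legal m p S -> legal m' p S.
Proof.
move=> mm' /andP[sS]; rewrite /legal sS /=; case: (to_move p) => //.
move=> /existsP[A /andP[cA SA]]; apply/existsP; exists A.
by rewrite SA (leq_trans cA).
Qed.

Lemma legal_Maker (n m m' : nat) (p : position n) S :
  to_move p = Maker -> legal m p S = legal m' p S.
Proof. by rewrite /legal => ->. Qed.

Lemma Breaker_wins_leq (n m m' : nat) (first : player) :
  m <= m' -> wins n m first Breaker -> wins n m' first Breaker.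
Proof.
move=> mm' [sigma ws]; exists sigma => p h ar.
have /ws [lg w] : arises m first Breaker sigma p h.
  elim: ar => {p h} [|p h _ Ip up tp|p h S _ Ip up tp lS].
  - exact: arises_start.
  - exact: arises_own.
  - by apply: arises_opponent => //; rewrite (legal_Maker _ m').
by split=> // up tp; apply: legal_leq (lg up tp).
Qed.

Lemma Maker_wins_leq (n m m' : nat) (first : player) :
  m <= m' -> wins n m' first Maker -> wins n m first Maker.
Proof.
move=> mm' [sigma ws]; exists sigma => p h ar.
have /ws [lg w] : arises m' first Maker sigma p h.
  elim: ar => {p h} [|p h _ Ip up tp|p h S _ Ip up tp lS].
  - exact: arises_start.
  - exact: arises_own.
  - by apply: arises_opponent => //; apply: legal_leq lS.
by split=> // up tp; rewrite (legal_Maker _ m') //; apply: lg.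
Qed.

(* [m0] is the least [m >= q] for which Breaker wins with bias [m + 1]. *)
Lemma threshold_bias_between (n q r : nat) (first : player) :
  q <= r -> wins n q first Maker -> wins n r first Breaker ->
  exists m0, [/\ threshold_bias n first m0, q <= m0 & m0 <= r].
Proof.
move=> qr wq wr.
have ex : exists m, (q <= m) && `[< wins n m.+1 first Breaker >].
  exists r; rewrite qr; apply/asboolP; exact: Breaker_wins_leq wr.
case: (ex_minnP ex) => m0 /andP[qm0 /asboolP w0] min0; exists m0; split=> //.
  move=> m; split=> [m0m|mm0]; first exact: Breaker_wins_leq w0.
  have [mq|qm] := leqP m q; first exact: Maker_wins_leq wq.
  (* If Breaker won with this bias [m > q], then [m - 1] would be a smaller candidate than [m0]. *)
  have [//|wm] := determinacy n m first.
  suff : m0 <= m.-1 by case: m {wm} mm0 qm => // m /leq_trans h _ /h; rewrite ltnn.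
  by apply: min0; case: m {mm0} qm wm => // m qm wm; rewrite -ltnS qm; apply/asboolP.
by apply: min0; rewrite qr; apply/asboolP; apply: Breaker_wins_leq wr.
Qed.
From mathcomp Require Import zify.

(** * Breaker isolates a vertex *)

Lemma cards2_mem (T : finType) (e : {set T}) (v : T) :
  #|e| = 2 -> v \in e -> exists2 x, x != v & e = [set v; x].
Proof.
move=> /eqP /cards2P [x [y [xy ->]]]; rewrite !inE => /orP[] /eqP ->.
  by exists y => //; rewrite eq_sym.
by exists x => //; rewrite setUC.
Qed.

Lemma card_ord_block (n s c : nat) :
  #|[set x : 'I_n | c <= x < c + s]| <= s.
Proof.
case: s => [|s].
  rewrite leqn0 cards_eq0; apply/eqP/setP => x; rewrite !inE; lia.
rewrite -[leqRHS]card_ord -(@card_in_imset _ _ (fun x : 'I_n => inord (x - c) : 'I_s.+1)).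
  exact: max_card.
move=> x y; rewrite !inE => hx hy /(congr1 val); rewrite /= !inordK; try lia.
by move=> h; apply: val_inj => /=; lia.
Qed.

Lemma subset_of_card (T : finType) (A : {set T}) (k : nat) :
  k <= #|A| -> exists2 B : {set T}, B \subset A & #|B| = k.
Proof.
move=> kA; have [s us sA] : exists2 s : seq T, uniq s & size s = k /\ {subset s <= A}.
  exists (take k (enum A)); first by rewrite take_uniq ?enum_uniq.
  split=> [|x /mem_take]; last by rewrite mem_enum.
  by rewrite size_takel // -cardE.
case: sA => <- sA; exists [set x in s]; last by rewrite cardsE (card_uniqP us).
by apply/subsetP => x; rewrite inE => /sA.
Qed.

Definition untouched (n : nat) (p : position n) (v : 'I_n) : Prop :=
  forall e, e \in maker_edges p -> v \notin e.

Definition blocked (n : nat) (p : position n) (v : 'I_n) (c : nat) : Prop :=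
  forall x : 'I_n, x < c -> x != v -> [set v; x] \in breaker_edges p.

Lemma untouched_disconnected (n : nat) (p : position n) (v : 'I_n) :
  1 < n -> untouched p v -> ~ spanning_connected (maker_edges p).
Proof.
move=> n1 uv sc.
have [w wv] : exists w : 'I_n, w != v.
  have : 0 < #|[set~ v]| by rewrite cardsC1 card_ord; lia.
  by move=> /card_gt0P [w]; rewrite !inE => ?; exists w.
have /connectP [[|x r] /= pth lst] := sc v w; first by rewrite lst eqxx in wv.
by case/andP: pth => /uv; rewrite !inE eqxx.
Qed.

(* Worst-case number of surviving vertices after a level that begins with [t]
   of them: they are served in [t %/ s + 2] batches of [s], and Maker touches
   two vertices after each batch.  Rounding up needs one extra batch; the
   second one leaves room for the two vertices touched when Maker starts. *)
Definition survivors (s t : nat) : nat := t - 2 * (t %/ s + 2).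

Section BreakerStrategy.
Variables (n m s L : nat) (first : player).
Hypotheses (s_gt1 : 1 < s) (s_le : 2 * s <= m) (n_le : n <= L * s).
(** The guaranteed number of survivors at the start of level [i]. The two vertices left out of [a 0]
    may be touched by Maker before Breaker's first move. *)
Let a (i : nat) : nat := iter i (survivors s) (n - 2).
Hypothesis aL_gt0 : 0 < a L.

Let a_gt0 i : i <= L -> 0 < a i.
Proof.
move=> iL; have : 0 < a (i + (L - i)) by rewrite subnKC.
elim: (L - i) => [|d IH]; first by rewrite addn0.
by rewrite addnS => h; apply: IH; apply: leq_trans h (leq_subr _ _).
Qed.

Let n_gt2 : 2 < n.
Proof. by have := a_gt0 (leq0n L); rewrite /a /=; lia. Qed.

Let a_batch i : a i + 2 <= (a i %/ s + 2) * s.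
Proof. have := ltn_ceil (a i) (ltnW s_gt1); nia. Qed.

(** Positivity of [a i.+1] makes the truncated subtraction in [survivors] exact. *)
Let a_step i : i < L -> a i.+1 + 2 * (a i %/ s + 2) <= a i.
Proof. by move=> /a_gt0; rewrite {1 2}/a /= -/(a i) /survivors; lia. Qed.

Definition isolating (p : position n) : Prop :=
  exists2 v, untouched p v & blocked p v n.

(* In level [i] Breaker claims the edges from the surviving set [T] to the
   vertices in [i * s, (i + 1) * s); [Q] contains the survivors still to be
   served, [k] batches are left, and [d] is the number of vertices that Maker
   may touch before Breaker's next move. *)
Definition stage (p : position n) (i k : nat) (T Q : {set 'I_n}) (d : nat) :=
  [/\ i < L,
      forall v, v \in T -> untouched p v /\ blocked p v (i * s),
      forall v, v \in T -> v \notin Q -> blocked p v (i.+1 * s),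
      #|Q| <= k * s
    & a i.+1 + 2 * k + d <= #|T|].

Definition isolation_invariant (p : position n) : Prop :=
  isolating p \/ exists i k T Q,
    stage p i k T Q (if to_move p is Maker then 2 else 0).

Let invariant_start : isolation_invariant (start n first).
Proof.
have L_gt0 : 0 < L by case: (L) n_le => //; lia.
right; exists 0, (a 0 %/ s + 2), [set: 'I_n], [set: 'I_n].
have step := a_step L_gt0; have batch := a_batch 0.
have n2 : a 0 + 2 = n by rewrite subnK // ltnW.
split=> //.
- by move=> v _; split=> [e|x]; rewrite ?inE ?mul0n.
- by move=> v _; rewrite inE.
- by rewrite cardsT card_ord -{1}n2.
- rewrite cardsT card_ord -[leqRHS]n2; apply: leq_add => //.
  by case: (to_move _).
Qed.

Let invariant_untouched p : isolation_invariant p -> exists v, untouched p v.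
Proof.
case=> [[v uv _]|[i [k [T [Q [iL hT _ _ cT]]]]]]; first by exists v.
have : 0 < #|T|.
  by apply: leq_trans cT; rewrite -addnA ltn_addr // a_gt0.
by case/card_gt0P => v /hT [uv _]; exists v.
Qed.

Let invariant_Maker_move p S : isolation_invariant p -> to_move p = Maker ->
  legal m p S -> isolation_invariant (claim p S).
Proof.
move=> Ip tp /andP[]; rewrite tp => /subsetP Su /cards1P [e Se].
have : e \in unclaimed p by apply: Su; rewrite Se set11.
rewrite !inE negb_or => /andP[/andP[eM eB] /eqP ce].
rewrite /claim tp Se.
have keep v : untouched p v -> v \notin e ->
    untouched (Position Breaker (maker_edges p :|: [set e]) (breaker_edges p)) v.
  by move=> uv ve f /=; rewrite !inE => /orP[/uv//|/eqP ->].
case: Ip => [[v uv bv]|[i [k [T [Q [iL hT hQ cQ cT]]]]]].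
  left; exists v; last exact: bv.
  apply: keep => //; apply/negP => ve.
  have [x xv ex] := cards2_mem ce ve.
  by move: eB; rewrite ex (bv x) ?ltn_ord.
(* Only the two endpoints of [e] can leave [T], which uses up the reserve [d = 2]. Touched vertices
   may stay in [Q]. *)
right; exists i, k, (T :\: e), Q; split=> //.
- move=> v; rewrite inE => /andP[ve /hT [uv bv]]; split; [exact: keep|exact: bv].
- by move=> v; rewrite inE => /andP[_ /hQ h] /h.
- have := cardsID e T; have := subset_leq_card (subsetIr T e).
  rewrite ce; have {cT} : a i.+1 + 2 * k + 2 <= #|T| by move: cT; rewrite tp.
  by rewrite [to_move _]/= addn0; lia.
Qed.

Let blocked_claim (p : position n) S v c : to_move p = Breaker ->
  blocked p v c -> blocked (claim p S) v c.
Proof. by move=> tp bv x xc xv; rewrite /claim tp /= inE bv. Qed.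

Let untouched_claim (p : position n) S v : to_move p = Breaker ->
  untouched p v -> untouched (claim p S) v.
Proof. by move=> tp uv e; rewrite /claim tp; apply: uv. Qed.

(** When no batch is left, [Q] is empty and the level is complete: either the next level starts or,
    since [n <= L * s], any vertex of [T] is isolated. *)
Let stage_progress p : to_move p = Breaker -> isolation_invariant p ->
  isolating p \/ exists i k T Q, stage p i k.+1 T Q 0.
Proof.
move=> tp [|[i [k [T [Q]]]]]; first by left.
rewrite tp; case: k => [|k] st; last by right; exists i, k, T, Q.
case: st => iL hT hQ cQ cT.
have {hQ} hT' v : v \in T -> untouched p v /\ blocked p v (i.+1 * s).
  move=> vT; have [uv _] := hT v vT; split=> //; apply: hQ => //.
  by move: cQ; rewrite mul0n leqn0 cards_eq0 => /eqP ->; rewrite inE.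
have ai := a_gt0 iL; have [iL'|Li] := ltnP i.+1 L.
  have [T1 sT1 cT1] : exists2 T1 : {set _}, T1 \subset T & #|T1| = a i.+1.
    by apply: subset_of_card; lia.
  (* Surplus survivors were dropped so that the batches counted from [a i.+1] suffice. The goal has
     [k.+1] batches, hence [+ 1] rather than [+ 2]. *)
  right; exists i.+1, (a i.+1 %/ s + 1), T1, T1; split=> //.
  - by move=> v /(subsetP sT1) /hT'.
  - by move=> v ->.
  - have := a_batch i.+1; rewrite cT1; lia.
  - have := a_step iL'; rewrite cT1; lia.
have : 0 < #|T| by lia.
case/card_gt0P => v /hT' [uv bv]; left; exists v => // x _; apply: bv.
have := ltn_ord x; nia.
Qed.

Let invariant_Breaker_move p : isolation_invariant p -> to_move p = Breaker ->
  exists2 S, legal m p S & isolation_invariant (claim p S).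
Proof.
move=> Ip tp; case: (stage_progress tp Ip) => [[v uv bv]|].
  exists set0; last first.
    by left; exists v; [exact: untouched_claim|exact: blocked_claim].
  rewrite /legal sub0set tp; apply/existsP; exists set0.
  by rewrite cards0 /cover big_set0 sub0set.
move=> [i [k [T [Q [iL hT hQ cQ cT]]]]].
have [B sB cB] : exists2 B : {set _}, B \subset Q & #|B| = minn s #|Q|.
  by apply: subset_of_card; lia.
pose X := [set x : 'I_n | i * s <= x < i * s + s].
have cX : #|X| <= s by apply: card_ord_block.
(* Free edges inside [B] or inside [X] are taken as well; this is harmless, and the move still spans
   at most [2 * s <= m] vertices. *)
pose S := unclaimed p :&: [set e : {set _} | e \subset B :|: X].
exists S.
  rewrite /legal subsetIl tp; apply/existsP; exists (B :|: X); apply/andP; split.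
    apply: leq_trans s_le; rewrite cardsU mul2n -addnn.
    by rewrite (leq_trans (leq_subr _ _)) // leq_add // cB geq_minl.
  by apply/bigcupsP => e; rewrite !inE => /andP[].
(* Passing from [2 * k.+1] to [2 * k] frees the reserve of 2 for Maker's reply. *)
right; exists i, k, T, (Q :\: B).
have -> : to_move (claim p S) = Maker by rewrite /claim tp.
split=> //.
- by move=> v /hT [uv bv]; split; [exact: untouched_claim|exact: blocked_claim].
- move=> v vT; rewrite inE negb_and negbK => vBQ.
  have [vQ|vQ] := boolP (v \in Q); last exact/blocked_claim/hQ.
  have vB : v \in B by move: vBQ; rewrite vQ orbF.
  have [uv bv] := hT v vT => x xi xv; rewrite /claim tp /= inE.
  have [xlt|xge] := ltnP x (i * s); first by rewrite bv.
  apply/orP; case: (boolP (_ \in breaker_edges p)) => eB; [by left|right].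
  rewrite !inE (negbTE eB) orbF cards2 [v == x]eq_sym xv andbT; apply/andP; split.
    by apply/negP => /uv; rewrite !inE eqxx.
  apply/subsetP => y; rewrite !inE => /orP[] /eqP ->; first by rewrite vB.
  by rewrite xge /=; move: xi; rewrite mulSn addnC => ->; rewrite orbT.
- by have := cardsID B Q; rewrite (setIidPr sB); lia.
- lia.
Qed.

Lemma Breaker_isolates : wins n m first Breaker.
Proof.
apply: safe_wins invariant_start => p Ip; split=> [_|_ tp|_ tp].
- have [v uv] := invariant_untouched Ip; apply: untouched_disconnected uv; lia.
- exact: invariant_Breaker_move.
- by move=> S; apply: invariant_Maker_move.
Qed.

End BreakerStrategy.

(** * Maker hits every cut *)

Lemma leq_card_edges_in (n : nat) (S : {set {set 'I_n}}) (A : {set 'I_n}) :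
  S \subset edges n -> cover S \subset A -> #|S| <= #|A| ^ 2.
Proof.
move=> /subsetP Se /bigcupsP SA.
have <- : #|setX A A| = #|A| ^ 2 by rewrite cardsX expnS expn1.
apply: leq_trans (leq_imset_card (fun z => [set z.1; z.2]) _).
apply: subset_leq_card; apply/subsetP => e eS.
have := Se _ eS; rewrite inE => /cards2P [x [y [_ exy]]].
apply/imsetP; exists (x, y) => //; rewrite inE /=.
have /subsetP eA := SA e eS.
by rewrite !eA // exy !inE eqxx ?orbT.
Qed.

Lemma unclaimed_claim (n : nat) (p : position n) S :
  unclaimed (claim p S) = unclaimed p :\: S.
Proof.
rewrite /claim /unclaimed; case: (to_move p) => /=; last by rewrite setUA setDDl.
by rewrite setUAC setDDl.
Qed.

Definition cut (n : nat) (A : {set 'I_n}) : {set {set 'I_n}} :=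
  [set [set z.1; z.2] | z in setX A (~: A)].

Lemma cutP (n : nat) (A : {set 'I_n}) (e : {set 'I_n}) :
  reflect (exists x y, [/\ x \in A, y \notin A & e = [set x; y]]) (e \in cut A).
Proof.
apply: (iffP imsetP) => [[[x y]]|[x [y [xA yA ->]]]].
  by rewrite !inE /= => /andP[xA yA] ->; exists x, y.
by exists (x, y) => //; rewrite !inE /= xA.
Qed.

Lemma cut_edges (n : nat) (A : {set 'I_n}) : cut A \subset edges n.
Proof.
apply/subsetP => e /cutP [x [y [xA yA ->]]]; rewrite inE cards2.
by have -> : x != y by apply: contraNneq yA => <-.
Qed.

Lemma card_cut (n : nat) (A : {set 'I_n}) : #|cut A| = #|A| * (n - #|A|).
Proof.
rewrite card_in_imset; first by rewrite cardsX [#|~: A|]cardsCs setCK card_ord.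
move=> [x y] [x' y']; rewrite !inE /= => /andP[xA yA] /andP[xA' yA'] E.
have : x \in [set x'; y'] by rewrite -E !inE eqxx.
have : y \in [set x'; y'] by rewrite -E !inE eqxx orbT.
rewrite !inE => /orP[] /eqP ? /orP[] /eqP ?; subst => //.
all: by move: yA yA'; rewrite ?xA ?xA'.
Qed.

(** No edge of [E] leaves the component [C] of [u]. If [C] misses [v], then [C] or its complement,
    whichever is smaller, gives an unhit cut. *)
Lemma cuts_hit_connected (n : nat) (E : {set {set 'I_n}}) :
  (forall A : {set 'I_n}, A != set0 -> 2 * #|A| <= n ->
     ~~ [disjoint cut A & E]) ->
  spanning_connected E.
Proof.
move=> hit u v; apply/negPn/negP => nuv.
pose C := [set x | connect (fun x y => [set x; y] \in E) u x].
have cross (x y : 'I_n) : x \in C -> y \notin C -> [set x; y] \in E -> False.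
  rewrite !inE => ux /negP uy xyE; apply: uy; apply: connect_trans ux _.
  exact: connect1.
have [le|lt] := leqP (2 * #|C|) n.
  have C0 : C != set0 by apply/set0Pn; exists u; rewrite inE connect0.
  have /pred0Pn [e /andP[/cutP [x [y [xC yC ->]]]]] := hit C C0 le.
  exact: cross.
have C0 : ~: C != set0 by apply/set0Pn; exists v; rewrite !inE.
have le : 2 * #|~: C| <= n by have := cardsC C; rewrite card_ord; lia.
have /pred0Pn [e /andP[/cutP [x [y [xC yC ->]]]]] := hit _ C0 le.
by rewrite /= setUC; apply: cross => //; [rewrite inE negbK in yC|rewrite inE in xC].
Qed.

From mathcomp Require Import all_order all_algebra ring lra.
Import Order.TTheory GRing.Theory Num.Theory.
Local Open Scope ring_scope.

Section MakerStrategy.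
Variables (R : realFieldType) (n m b : nat) (first : player).
Variables (T : finType) (P : pred T) (F : T -> {set {set 'I_n}}) (lam : R).
Hypotheses (b_gt0 : (0 < b)%N) (m_le : (m ^ 2 <= b)%N) (lam_ge1 : 1 <= lam).
Hypothesis lam_exp : forall j, (j <= b)%N -> lam ^+ j <= 1 + j%:R / b%:R.
Hypothesis F_edges : forall i, P i -> F i \subset edges n.
Hypothesis F_small : \sum_(i | P i) lam ^- #|F i| < 1 / 2.

Definition weight (p : position n) (i : T) : R :=
  if [disjoint F i & maker_edges p] then lam ^- #|F i :&: unclaimed p| else 0.

Definition potential (p : position n) : R := \sum_(i | P i) weight p i.

Definition potential_at (p : position n) (e : {set 'I_n}) : R :=
  \sum_(i | P i && (e \in F i)) weight p i.

Let lam_gt0 : 0 < lam. Proof. exact: lt_le_trans lam_ge1. Qed.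

Let weight_ge0 p i : 0 <= weight p i.
Proof. by rewrite /weight; case: ifP => // _; rewrite invr_ge0 exprn_ge0 // ltW. Qed.

Let potential_at_ge0 p e : 0 <= potential_at p e.
Proof. exact: sumr_ge0. Qed.

Let weight_Maker p e i : to_move p = Maker ->
  weight (claim p [set e]) i = if e \in F i then 0 else weight p i.
Proof.
move=> tp; rewrite /weight unclaimed_claim.
have -> : maker_edges (claim p [set e]) = maker_edges p :|: [set e].
  by rewrite /claim tp.
rewrite -!setI_eq0 setIUr setU_eq0 [_ :&: [set e] == _]setI_eq0.
rewrite disjoint_sym disjoints1; case: (boolP (e \in F i)) => eF /=.
  by rewrite andbF.
rewrite andbT; congr (if _ then lam ^- _ else _).
congr #|pred_of_set _|; apply/setP => f; rewrite !inE.
by case: (eqVneq f e) => // ->; rewrite (negbTE eF).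
Qed.

Let potential_Maker p e : to_move p = Maker ->
  potential (claim p [set e]) = potential p - potential_at p e.
Proof.
move=> tp; rewrite /potential /potential_at.
rewrite [X in _ = X - _](bigID (fun i => e \in F i)) /= addrAC subrr add0r.
rewrite (bigID (fun i => e \in F i)) /= big1 ?add0r => [|i /andP[_ eF]].
  by apply: eq_bigr => i /andP[_ eF]; rewrite weight_Maker // (negbTE eF).
by rewrite weight_Maker // eF.
Qed.

Let potential_at_Maker p e f : to_move p = Maker ->
  potential_at (claim p [set e]) f <= potential_at p f.
Proof. by move=> tp; apply: ler_sum => i _; rewrite weight_Maker //; case: ifP. Qed.

Let card_Breaker_move (p : position n) S :
  to_move p = Breaker -> legal m p S -> (#|S| <= b)%N.
Proof.
move=> tp /andP[Su]; rewrite tp => /existsP [A /andP[cA SA]].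
apply: leq_trans m_le; apply: leq_trans (_ : #|A| ^ 2 <= _)%N.
  by apply: leq_card_edges_in SA; apply: subset_trans Su (subsetDl _ _).
by rewrite leq_exp2r.
Qed.

(** By [lam_exp], losing [j <= b] free edges multiplies the weight by at most [1 + j / b]. This is
    linear in [j], so the increase can be charged to the claimed edges one by one. *)
Let weight_Breaker p S i : to_move p = Breaker -> legal m p S ->
  weight (claim p S) i <= weight p i * (1 + #|F i :&: S|%:R / b%:R).
Proof.
move=> tp lS; rewrite /weight unclaimed_claim.
have -> : maker_edges (claim p S) = maker_edges p by rewrite /claim tp.
case: ifP => _; last by rewrite mul0r.
have Su : S \subset unclaimed p by case/andP: lS.
have -> : #|F i :&: unclaimed p| =
    (#|F i :&: S| + #|F i :&: (unclaimed p :\: S)|)%N.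
  by rewrite -(cardsID S) -setIA (setIidPr Su) -setIDA.
rewrite exprD invfM mulrAC -[leLHS]mul1r ler_wpM2r ?invr_ge0 ?exprn_ge0 ?(ltW lam_gt0) //.
rewrite mulrC ler_pdivlMr ?exprn_gt0 // mul1r; apply: lam_exp.
apply: leq_trans (card_Breaker_move tp lS); exact/subset_leq_card/subsetIr.
Qed.

Let potential_Breaker p S : to_move p = Breaker -> legal m p S ->
  potential (claim p S) <=
  potential p + (\sum_(e in S) potential_at p e) / b%:R.
Proof.
move=> tp lS; apply: le_trans (ler_sum _ (fun i _ => weight_Breaker i tp lS)) _.
under eq_bigr do rewrite mulrDr mulr1.
rewrite big_split lerD2l /potential_at (exchange_big_dep P) /=; last first.
  by move=> ? ? _ /andP[].
rewrite mulr_suml; apply: ler_sum => i Pi.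
rewrite mulrA ler_wpM2r ?invr_ge0 // mulr_natr.
rewrite -sumr_const le_eqVlt; apply/orP; left; apply/eqP.
by apply: eq_bigl => e; rewrite inE Pi andbC.
Qed.

(** Breaker claims at most [b] edges, each adding at most a [b]-th of the largest [potential_at].
    The second clause leaves room for this. *)
Definition potential_invariant (p : position n) : Prop :=
  potential p < 1 /\
  (to_move p = Breaker -> forall e, e \in unclaimed p ->
     potential p + potential_at p e < 1).

Let invariant_start : potential_invariant (start n first).
Proof.
have eqp : potential (start n first) = \sum_(i | P i) lam ^- #|F i|.
  apply: eq_bigr => i Pi; rewrite /weight /= -setI_eq0 setI0 eqxx /unclaimed /=.
  by rewrite setU0 setD0 (setIidPl (F_edges Pi)).
have le_at e : potential_at (start n first) e <= potential (start n first).
  by rewrite /potential (bigID (fun i => e \in F i)) /= lerDl sumr_ge0.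
split=> [|_ e _]; first by rewrite eqp; have := F_small; lra.
(* Breaker may move first, so the initial sum must fit twice below 1: hence the bound [1 / 2] in
   [F_small]. *)
apply: le_lt_trans (lerD (lexx _) (le_at e)) _.
by rewrite eqp [ltRHS](splitr 1) ltrD.
Qed.

Lemma Maker_hits_family :
  (forall E : {set {set 'I_n}},
     (forall i, P i -> ~~ [disjoint F i & E]) -> spanning_connected E) ->
  wins n m first Maker.
Proof.
move=> hit; apply: safe_wins invariant_start => p [p1 pB]; split=> [up|up tp|up tp S lS].
(* At the end an unhit set has no free edge, so it alone weighs [lam ^- 0 = 1]. *)
- apply: hit => i Pi; apply/negP => dis; move: p1; apply/negP; rewrite -leNgt.
  rewrite /potential (bigD1 i) //= {1}/weight dis up setI0 cards0 expr0 invr1.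
  by rewrite lerDl sumr_ge0.
- have /set0Pn [e0 ue0] : unclaimed p != set0 by apply/eqP.
  case: (arg_maxP (potential_at p) ue0) => e ue maxe.
  have {}ue : e \in unclaimed p by [].
  have lS : legal m p [set e] by rewrite /legal sub1set ue tp cards1 eqxx.
  exists [set e] => //; split.
    by rewrite potential_Maker //; apply: le_lt_trans p1; rewrite gerBl.
  (* Claiming [e] removed [potential_at p e], and no free edge [f] weighs more than that, so the two
     terms add up to at most [potential p]. *)
  move=> _ f; rewrite unclaimed_claim inE => /andP[_ uf].
  rewrite potential_Maker //; apply: le_lt_trans p1.
  rewrite -addrA gerDl addrC subr_le0.
  exact: le_trans (potential_at_Maker _ _ tp) (maxe f uf).
- split; last by rewrite /claim tp.
  apply: le_lt_trans (potential_Breaker tp lS) _.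
  have [->|/set0Pn [e0 Se0]] := eqVneq S set0; first by rewrite big_set0 mul0r addr0.
  case: (arg_maxP (potential_at p) Se0) => e Se maxe.
  have Su : S \subset unclaimed p by case/andP: lS.
  apply: le_lt_trans (pB tp e (subsetP Su _ Se)).
  rewrite lerD2l ler_pdivrMr ?ltr0n //.
  apply: (@le_trans _ _ (\sum_(f in S) potential_at p e)).
    by apply: ler_sum => f /maxe.
  rewrite sumr_const -[leLHS]mulr_natr ler_wpM2l ?ler_nat //; exact: card_Breaker_move lS.
Qed.

End MakerStrategy.

Lemma sum_subsets_exp (R : comNzRingType) (T : finType) (x : R) :
  \sum_(A : {set T}) x ^+ #|A| = (1 + x) ^+ #|T|.
Proof.
rewrite -prodr_const addrC bigA_distr /=; apply: eq_big => // A _.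
rewrite (bigID (mem A)) /= [X in _ * X]big1 ?mulr1; last by move=> i /negbTE ->.
by rewrite -prodr_const; apply: eq_bigr => i ->.
Qed.

(** If [#|A| <= n / 2], the cut of [A] has at least [#|A| * n./2] edges and weighs at most
    [(lam ^- n./2) ^+ #|A|]. Over nonempty [A] these bounds sum to [(1 + lam ^- n./2) ^+ n - 1]. *)
Lemma Maker_connects (R : realFieldType) (n m b : nat) (first : player) (lam : R) :
  (0 < b)%N -> (m ^ 2 <= b)%N -> 1 <= lam ->
  (forall j, (j <= b)%N -> lam ^+ j <= 1 + j%:R / b%:R) ->
  (1 + lam ^- n./2) ^+ n < 3 / 2 ->
  wins n m first Maker.
Proof.
move=> b0 mb lam1 lamj small.
have lam0 : 0 < lam by apply: lt_le_trans lam1.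
pose P (A : {set 'I_n}) := (A != set0) && (2 * #|A| <= n)%N.
apply: (@Maker_hits_family R n m b first _ P (@cut n) lam) => //.
- by move=> A _; apply: cut_edges.
- apply: (@le_lt_trans _ _ (\sum_(A : {set 'I_n} | A != set0) (lam ^- n./2) ^+ #|A|)).
    rewrite [leRHS](bigID P) /= -[leLHS]addr0 lerD //; last first.
      by apply: sumr_ge0 => A _; rewrite exprn_ge0 // invr_ge0 exprn_ge0 // ltW.
    rewrite [leRHS](eq_bigl P); last by move=> A; rewrite /P andbA andbb.
    apply: ler_sum => A /andP[_ cA]; rewrite card_cut exprVn -exprM.
    rewrite lef_pV2 ?posrE ?exprn_gt0 //; apply: ler_weXn2l => //.
    by rewrite mulnC leq_mul2l; apply/orP; right; lia.
  have := sum_subsets_exp 'I_n (lam ^- n./2).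
  rewrite (bigD1 set0) //= cards0 expr0 card_ord => E.
  rewrite -(ltrD2l 1) E; apply: lt_le_trans small _.
  by lra.
- by move=> E hit; apply: cuts_hit_connected => A A0 cA; apply: hit; rewrite /P A0.
Qed.

(* Adding [2 * s] turns the affine recursion [t -> (1 - 2 / s) t - 4] into a
   geometric one. *)
Lemma iter_survivors_ge (R : realFieldType) (s t i : nat) : (1 < s)%N ->
  (t%:R + 2 * s%:R) * (1 - 2 / s%:R) ^+ i <=
  (iter i (survivors s) t)%:R + 2 * s%:R :> R.
Proof.
move=> s1; have s0 : 0 < s%:R :> R by rewrite ltr0n ltnW.
have rho0 : 0 <= 1 - 2 / s%:R :> R.
  by rewrite subr_ge0 ler_pdivrMr // mul1r ler_nat.
elim: i => [|i IH]; first by rewrite expr0 mulr1.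
rewrite exprSr mulrA; apply: le_trans (ler_wpM2r rho0 IH) _.
rewrite iterS; move: (iter i _ t) => u.
have hdiv : (u %/ s)%:R <= u%:R / s%:R :> R.
  by rewrite ler_pdivlMr // -natrM ler_nat leq_divM.
have hsub : u%:R - 2 * ((u %/ s)%:R + 2) <= (survivors s u)%:R :> R.
  by rewrite lerBlDr -natrD -natrM -natrD ler_nat /survivors; lia.
have -> : (u%:R + 2 * s%:R) * (1 - 2 / s%:R) =
    u%:R - 2 * (u%:R / s%:R) - 4 + 2 * s%:R :> R.
  by field; rewrite gt_eqF.
lra.
Qed.

From mathcomp Require Import all_classical all_reals all_analysis.
Import numFieldNormedType.Exports.

(** * Choice of constants and asymptotics *)

Section Asymptotics.
Variables (R : realType) (n : nat) (first : player) (l x : R).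
Hypotheses (l_ge : 400 <= l) (natE : n%:R = expR l).
Hypotheses (x_ge0 : 0 <= x) (x_sqr : x ^+ 2 * l = n%:R).

Let expR_half_sqr : expR (l / 2) ^+ 2 = n%:R.
Proof. by rewrite natE expr2 -expRD -splitr. Qed.

(** [x ^+ 2 = expR (l / 2) ^+ 2 / l >= (1 + l / 2) ^+ 2 / l >= l / 4 >= 100]. *)
Let x_ge10 : 10 <= x.
Proof.
have lge := l_ge.
have := expR_ge1Dx (l / 2); have := expR_half_sqr; have := x_sqr.
move: (expR _) => y xn yn yl; rewrite -yn in xn.
rewrite -ler_sqr ?nnegrE ?ler0n //.
rewrite -(@ler_pM2r _ l); last by lra.
by rewrite xn; nra.
Qed.

Let s : nat := (Num.truncn (4 * x)).+1.

Let s_itv : 4 * x < s%:R <= 4 * x + 1.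
Proof.
have /andP[lo hi] : (Num.truncn (4 * x))%:R <= 4 * x < s%:R.
  by apply: truncn_itv; rewrite mulr_ge0.
by rewrite hi /s -[leLHS]natr1 lerD2r.
Qed.

(** The decay factor over all levels is at least [expR (- (l / 2))], so the geometric bound is at
    least [expR (l / 2) >= 20 * x], which exceeds the correction [2 * s]. *)
Lemma Breaker_wins_large_bias : wins n (2 * s) first Breaker.
Proof.
have /andP[s_lo s_hi] := s_itv; have x10 := x_ge10; have lge := l_ge.
have s1 : (1 < s)%N by rewrite -(ltr_nat R); lra.
have s0 : 0 < s%:R :> R by lra.
apply: (@Breaker_isolates n (2 * s) s (n %/ s).+1) => //.
  exact/ltnW/ltn_ceil/ltnW.
rewrite lt0n; apply/negP => /eqP surv0.
have := iter_survivors_ge R (n - 2) (n %/ s).+1 s1; rewrite surv0 add0r.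
apply/negP; rewrite -ltNge.
pose z : R := 4 / s%:R.
have zs : z * s%:R = 4 by rewrite /z divfK // gt_eqF.
have z0 : 0 < z by rewrite divr_gt0.
have z1 : z <= 1 by rewrite ler_pdivrMr // mul1r; lra.
have rhoE : 1 - 2 / s%:R = 1 - z / 2 :> R by rewrite /z; field; rewrite gt_eqF.
(* [expR z >= 1 + z], and [(1 - z / 2) * (1 + z) >= 1] for [0 <= z <= 1]. *)
have rho_ge : expR (- z) <= 1 - z / 2.
  rewrite expRN -div1r ler_pdivrMr ?expR_gt0 //.
  apply: (@le_trans _ _ ((1 - z / 2) * (1 + z))); first by nra.
  by rewrite ler_wpM2l ?expR_ge1Dx //; lra.
(* The first [n %/ s] levels contribute at most [l / 4] because [s ^+ 2 >= 16 * x ^+ 2]; the last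
   one adds [z <= 1]. *)
have hL : z * (n %/ s).+1%:R <= l / 2.
  have hdiv : (n %/ s)%:R * s%:R <= n%:R :> R by rewrite -natrM ler_nat leq_divM.
  rewrite -natr1 mulrDr mulr1; move: hdiv (ler0n R (n %/ s)).
  move: (n %/ s)%:R => d ds d0.
  have sx : 16 * x ^+ 2 <= s%:R ^+ 2 by nra.
  have dl : z * d <= l / 4.
    rewrite -(@ler_pM2r _ (s%:R ^+ 2)) ?exprn_gt0 //.
    have -> : z * d * s%:R ^+ 2 = 4 * (d * s%:R) by rewrite -zs; ring.
    apply: (@le_trans _ _ (4 * n%:R)); first by rewrite ler_wpM2l.
    rewrite -x_sqr; have := @ler_wpM2r _ (l / 4) _ _ _ sx; nra.
  lra.
have rhoL : expR (- (l / 2)) <= (1 - z / 2) ^+ (n %/ s).+1.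
  apply: (@le_trans _ _ (expR (- z) ^+ (n %/ s).+1)); last first.
    by apply: lerXn2r => //; rewrite nnegrE ?expR_ge0 //; lra.
  by rewrite -expRM_natr ler_expR mulNr lerN2.
rewrite rhoE; set y := expR (l / 2).
have y0 : 0 < y by apply: expR_gt0.
have yge : 201 <= y by apply: le_trans (expR_ge1Dx _); lra.
have nE : n%:R = y ^+ 2 by rewrite expR_half_sqr.
have xy : 20 * x <= y.
  rewrite -ler_sqr ?nnegrE ?(ltW y0) //; last by lra.
  by rewrite -nE -x_sqr; nra.
apply: (@lt_le_trans _ _ y); first by lra.
have n2 : n%:R <= (n - 2)%:R + 2 * s%:R :> R.
  by rewrite -natrM -natrD ler_nat addnC -leq_subLR leq_sub2l // leq_pmulr.
apply: (@le_trans _ _ (y ^+ 2 * expR (- (l / 2)))).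
  by rewrite expRN -/y expr2 mulfK // gt_eqF.
by apply: ler_pM => //; rewrite ?expR_ge0 ?sqr_ge0 // -nE.
Qed.

Let m : nat := Num.truncn (x / 5).

Let m_itv : m%:R <= x / 5 < m%:R + 1.
Proof. by rewrite natr1; apply: truncn_itv; rewrite divr_ge0. Qed.

(** Since [25 * m ^ 2 * l <= n], here [lam ^+ n./2 >= expR (2 * l) = n ^+ 2], so
    [(1 + lam ^- n./2) ^+ n] is at most [expR (1 / n)]. *)
Lemma Maker_wins_small_bias : wins n m first Maker.
Proof.
have /andP[m_lo m_hi] := m_itv; have x10 := x_ge10; have lge := l_ge.
have m0 : (0 < m)%N by rewrite -(ltr_nat R); lra.
pose b := (m ^ 2)%N; have b0 : (0 < b)%N by rewrite expn_gt0 m0.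
have bR : 0 < b%:R :> R by rewrite ltr0n.
have b_le : 25 * b%:R * l <= n%:R.
  by rewrite -x_sqr ler_wpM2r ?natrX //; nra.
apply: (@Maker_connects R n m b first (expR ((2 * b%:R)^-1))) => //.
- by rewrite -expR0 ler_expR invr_ge0 mulr_ge0.
- move=> j jb; rewrite -expRM_natr.
  have jb' : j%:R <= b%:R :> R by rewrite ler_nat.
  set u := _ * j%:R.
  (* For [0 <= u <= 1 / 2], [expR u <= 1 / (1 - u) <= 1 + 2 * u]. *)
  have -> : j%:R / b%:R = 2 * u by rewrite /u; field; rewrite gt_eqF.
  have u0 : 0 <= u by rewrite mulr_ge0 // invr_ge0 mulr_ge0.
  have u1 : u <= 1 / 2 by rewrite /u mulrC ler_pdivrMr ?mulr_gt0 //; lra.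
  have eu := expR_ge1Dx (- u).
  rewrite -(@ler_pM2r _ (1 - u)); last by lra.
  apply: (@le_trans _ _ 1); last by nra.
  by rewrite -[leRHS](expRxMexpNx_1 u) ler_wpM2l ?expR_ge0.
- have hexp : 2 * l <= (2 * b%:R)^-1 * n./2%:R.
    rewrite [leRHS]mulrC ler_pdivlMr ?mulr_gt0 //.
    have : n%:R <= n./2%:R * 2 + 1 :> R.
      rewrite -natrM natr1 ler_nat -addn1 muln2 -{1}(odd_double_half n) addnC.
      by rewrite leq_add2l leq_b1.
    by have := expR_ge1Dx l; rewrite -natE; nra.
  set th := _ ^- _.
  have th_le : th <= expR (- (2 * l)).
    by rewrite /th -expRM_natr -expRN ler_expR lerN2.
  have nth : n%:R * th <= 1 / 4.
    apply: (@le_trans _ _ (expR (- l))).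
      by rewrite (le_trans (ler_wpM2l _ th_le)) // natE -expRD ler_expR; lra.
    rewrite expRN -[leLHS]div1r ler_pdivrMr ?expR_gt0 //.
    by have := expR_ge1Dx l; lra.
  apply: (@le_lt_trans _ _ (expR (n%:R * th))).
    rewrite mulrC expRM_natr; apply: lerXn2r; rewrite ?nnegrE ?expR_ge0 ?expR_ge1Dx //.
    by rewrite addr_ge0 // invr_ge0 exprn_ge0 // expR_ge0.
  apply: (@le_lt_trans _ _ (4 / 3)); last by lra.
  have h : 3 / 4 <= expR (- (n%:R * th)) by apply: le_trans (expR_ge1Dx _); lra.
  have : expR (n%:R * th) * (3 / 4) <= 1.
    by rewrite -[leRHS](expRxMexpNx_1 (n%:R * th)) ler_wpM2l ?expR_ge0.
  by move: (expR _) => w; lra.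
Qed.

(** As [x >= 10], rounding is absorbed: [m > x / 5 - 1 >= x / 10] and
    [2 * s <= 8 * x + 2 <= 10 * x]. *)
Lemma threshold_bias_bounds : exists m0,
  [/\ threshold_bias n first m0, x / 10 <= m0%:R & m0%:R <= 10 * x].
Proof.
have /andP[s_lo s_hi] := s_itv; have /andP[m_lo m_hi] := m_itv; have x10 := x_ge10.
have ms : (m <= 2 * s)%N by rewrite -(ler_nat R) natrM; lra.
have [m0 [th mm0 m0s]] := threshold_bias_between ms Maker_wins_small_bias
  Breaker_wins_large_bias.
exists m0; split=> //.
  by apply: le_trans (_ : m%:R <= _); [lra|rewrite ler_nat].
by apply: (@le_trans _ _ (2 * s)%:R); [rewrite ler_nat|rewrite natrM; lra].
Qed.

End Asymptotics.

Local Open Scope classical_set_scope.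

Theorem theorem3p3 (R : realType) (first : player) :
  exists m0 : nat -> nat,
    (\forall n \near \oo, threshold_bias n first (m0 n)) /\
    ((fun n : nat => (m0 n)%:R : R) \is
       'Theta_\oo (fun n : nat => Num.sqrt (n%:R / ln n%:R) : R)).
Proof.
have ex (n : nat) : exists m0, 400 <= ln (n%:R : R) ->
    [/\ threshold_bias n first m0,
        Num.sqrt (n%:R / ln n%:R) / 10 <= m0%:R :> R
      & m0%:R <= 10 * Num.sqrt (n%:R / ln n%:R) :> R].
  (* Where [ln n < 400] the implication is vacuous and 0 serves as a default value. *)
  have [h|h] := pselect (400 <= ln (n%:R : R)); last by exists 0%N.
  have l0 : 0 < ln (n%:R : R) by rewrite (lt_le_trans _ h) ?ltr0n.
  have n0 : 0 < n%:R :> R.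
    by rewrite ltr0n lt0n; apply: contraTneq l0 => ->; rewrite ln0 ?ltxx.
  have [||||m0 Hm0] := @threshold_bias_bounds R n first (ln n%:R)
      (Num.sqrt (n%:R / ln n%:R)) => //; last by exists m0.
  - by rewrite lnK.
  - by rewrite sqr_sqrtr ?divfK ?gt_eqF // divr_ge0 // ltW.
have [m0 Hm0] := choice ex.
have large : \forall n \near \oo, 400 <= ln (n%:R : R).
  near=> n; have nn : expR 400 <= n%:R :> R by near: n; exact: nbhs_infty_ger.
  by rewrite -[leLHS]expRK ler_ln ?posrE ?expR_gt0 // (lt_le_trans (expR_gt0 _) nn).
exists m0; split.
  by near=> n; have [] := Hm0 n; first by near: n.
rewrite qualifE; apply/asboolP; exists (10^-1, 10) => /=.
  by rewrite invr_gt0 ltr0n.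
near=> n; have [|_ lo hi] := Hm0 n; first by near: n.
by rewrite !ger0_norm ?sqrtr_ge0 // mulrC.
Unshelve. all: by end_near. Qed.
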